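(* Let $B=\left(\frac{e}{\sqrt{2\pi}}\right)^3$. For all integers $k\ge 1$, $$R(3,k)\le 2^{B(k-1)^{1/2}2^{2k}}.$$
   Context: For a set $X$ and an integer $a\ge 1$, $\binom{X}{a}$ denotes the set of all $a$-element subsets of $X$, and $[n]=\{1,\dots,n\}$. Given a coloring $COL$ of $\binom{[n]}{a}$, a set $H\subseteq[n]$ is $a$-homogeneous for $COL$ if all elements of $\binom{H}{a}$ have the same color (vacuously true if $|H|<a$). For integers $a,k\ge 1$, $R(a,k)$ denotes the least $n$ such that for every 2-coloring of $\binom{[n]}{a}$ there exists an $a$-homogeneous set $H\subseteq [n]$ with $|H|=k$ (this number exists by Ramsey's theorem). *)

(* Defs.v *)
From mathcomp Require Import all_boot all_algebra.
From mathcomp Require Import all_reals all_analysis.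

Set Implicit Arguments.
Unset Strict Implicit.
Unset Printing Implicit Defensive.

(* The a-element subsets of X; the ground set [n] is 'I_n, i.e. {0, ..., n-1}. *)
Definition asubset (X : finType) (a : nat) := {A : {set X} | #|A| == a}.

Definition homogeneous (X : finType) (a : nat)
    (COL : {ffun asubset X a -> bool}) (H : {set X}) : bool :=
  [forall A : asubset X a, forall B : asubset X a,
     (val A \subset H) ==> (val B \subset H) ==> (COL A == COL B)].

Definition ramsey_prop (a k n : nat) : bool :=
  [forall COL : {ffun asubset 'I_n a -> bool},
     [exists H : {set 'I_n}, homogeneous COL H && (#|H| == k)]].

Lemma sub_of_card (T : finType) (S : {set T}) m :
  m <= #|S| -> exists2 H : {set T}, H \subset S & #|H| = m.
Proof.
elim: m => [|m IH] hm; first by exists set0; rewrite ?sub0set ?cards0.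
have [H HS cH] := IH (ltnW hm).
have : 0 < #|S :\: H| by rewrite cardsD (setIidPr HS) cH subn_gt0.
case/card_gt0P => x; rewrite inE => /andP[xH xS].
exists (x |: H); last by rewrite cardsU1 xH cH.
by rewrite subUset sub1set xS.
Qed.

(* Ramsey's theorem for a-subsets, in asymmetric two-colour form. *)
Lemma ramsey_asym (a : nat) (k0 k1 : nat) : exists n, forall (T : finType)
    (c : {set T} -> bool) (S : {set T}), n <= #|S| ->
  exists (b : bool) (H : {set T}), [/\ H \subset S, #|H| = (if b then k1 else k0)
    & forall A : {set T}, A \subset H -> #|A| = a -> c A = b].
Proof.
elim: a k0 k1 => [|a IHa] k0 k1.
  exists (maxn k0 k1) => T c S; rewrite geq_max => /andP[h0 h1].
  have [|H HS cH] := @sub_of_card T S (if c set0 then k1 else k0).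
    by case: (c set0).
  by exists (c set0), H; split=> // A _ /eqP; rewrite cards_eq0 => /eqP->.
have triv (T : finType) (c : {set T} -> bool) b (A : {set T}) :
    A \subset set0 -> #|A| = a.+1 -> c A = b.
  by rewrite subset0 => /eqP->; rewrite cards0.
elim: k0 k1 => [|k0 IH0] k1.
  by exists 0 => T c S _; exists false, set0; split; rewrite ?sub0set ?cards0 //; apply: triv.
elim: k1 => [|k1 [n2 IH1]].
  by exists 0 => T c S _; exists true, set0; split; rewrite ?sub0set ?cards0 //; apply: triv.
have [n1 {}IH0] := IH0 k1.+1.
have [n Hn] := IHa (maxn n1 n2) (maxn n1 n2).
exists n.+1 => T c S hS.
have /card_gt0P[x xS] : 0 < #|S| by apply: leq_trans hS.
have hS' : n <= #|S :\ x| by move: hS; rewrite (cardsD1 x S) xS add1n ltnS.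
have [b [H [HS cH hH]]] := Hn T (fun A => c (x |: A)) _ hS'.
rewrite if_same in cH.
have ext (H' : {set T}) : H' \subset H ->
    (forall A : {set T}, A \subset H' -> #|A| = a.+1 -> c A = b) ->
    [/\ x |: H' \subset S, #|x |: H'| = #|H'|.+1
      & forall A : {set T}, A \subset x |: H' -> #|A| = a.+1 -> c A = b].
  move=> sH' hc; have H'S := subset_trans sH' HS.
  have xH' : x \notin H'.
    by apply/negP => /(subsetP H'S); rewrite !inE eqxx.
  split; first by rewrite subUset sub1set xS (subset_trans H'S) // subsetDl.
    by rewrite cardsU1 xH'.
  move=> A sA cA; have [xA|xA] := boolP (x \in A); last first.
    apply: hc => //; apply/subsetP => y yA.
    have := subsetP sA _ yA; rewrite !inE => /orP[/eqP yx|//].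
    by rewrite -yx yA in xA.
  rewrite -(setD1K xA); apply: hH; last first.
    by move: cA; rewrite (cardsD1 x A) xA add1n => -[].
  by apply: subset_trans sH'; rewrite subDset.
have HS' : H \subset S by apply: subset_trans HS _; rewrite subsetDl.
case: b hH ext => hH ext.
  have [|[] [H' [sH' cH' hc]]] := IH1 T c H; first by rewrite cH leq_maxr.
    have [s1 s2 s3] := ext _ sH' hc.
    by exists true, (x |: H'); rewrite s2 cH'.
  by exists false, H'; split=> //; apply: subset_trans HS'.
have [|[] [H' [sH' cH' hc]]] := IH0 T c H; first by rewrite cH leq_maxl.
  by exists true, H'; split=> //; apply: subset_trans HS'.
have [s1 s2 s3] := ext _ sH' hc.
by exists false, (x |: H'); rewrite s2 cH'.
Qed.

Lemma ramsey_exists (a k : nat) : exists n, ramsey_prop a k n.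
Proof.
have [n hn] := ramsey_asym a k k; exists n; apply/forallP => COL.
pose c (A : {set 'I_n}) := if insub A is Some u then COL u else false.
have [|b [H [_ cH hH]]] := hn _ c [set: 'I_n]; first by rewrite cardsT card_ord.
have colE (A : asubset 'I_n a) : val A \subset H -> COL A = b.
  by move=> sA; rewrite -(hH _ sA (eqP (valP A))) /c valK.
apply/existsP; exists H; rewrite cH if_same eqxx andbT.
apply/forallP => A; apply/forallP => B; apply/implyP => sA; apply/implyP => sB.
by rewrite !colE.
Qed.

Definition ramsey (a k : nat) : nat := ex_minn (ramsey_exists a k).

Import GRing.Theory Num.Theory.
Local Open Scope ring_scope.

Definition ramsey_const (R : realType) : R := (expR 1 / Num.sqrt (2 * pi)) ^+ 3.

(* Main.v *)
(* Put m = k - 1 and expose vertices one at a time, keeping a set S of candidates.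
   The exposed vertices form a binary search tree: a new vertex x descends from the
   root, and at each visited vertex v the majority color b of {v, x, w} over w in S
   is declared the color of the pair {v, x}, x moves to the b-subtree of v, and S is
   cut down to the w whose triple has color b. This is the strategy of Conlon, Fox
   and Sudakov: only the pairs on a descent cost a factor 2, not all pairs as in
   Erdos and Rado. A tree in which no path branches m - 1 times to the same side
   above a vertex has fewer than 'C(2m, m) vertices and height less than 2m. Hence
   2 ^ (2m 'C(2m, m)) points suffice to get m vertices of one path all of whose pairs
   have the same color, plus one remaining candidate. Finally
   'C(2m, m) ^ 2 (2m + 1) <= 16 ^ m and B ^ 2 >= 1 / 8. *)
Require Import Defs.
From mathcomp Require Import all_boot all_order all_algebra.
From mathcomp Require Import all_reals all_analysis.
From mathcomp Require Import zify ring lra.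

(** * Binary trees with bounded branching to each side *)

Inductive vtree (T : Type) := leaf | node of T & vtree T & vtree T.
Arguments leaf {T}.
Arguments node {T}.

Fixpoint vertices {T : Type} (t : vtree T) : seq T :=
  if t is node v l r then v :: vertices l ++ vertices r else [::].

Fixpoint height {T : Type} (t : vtree T) : nat :=
  if t is node _ l r then (maxn (height l) (height r)).+1 else 0.

(* No path of [t] contains [p] vertices from which it is continued to the left, or
   [q] to the right, the last vertex of a path counting for both sides. *)
Fixpoint fits {T : Type} (p q : nat) (t : vtree T) : bool :=
  [&& 0 < p, 0 < q & if t is node _ l r then fits p.-1 q l && fits p q.-1 r
                     else true].

Lemma fits_height {T : Type} (p q : nat) (t : vtree T) :
  fits p q t -> height t < p + q.
Proof.
elim: t p q => [|v l IHl r IHr] [|p] [|q] //= /andP[/IHl hl /IHr hr].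
lia.
Qed.

(** Pascal's rule: the strict bounds for the two subtrees leave room for the root. *)
Lemma fits_size {T : Type} (p q : nat) (t : vtree T) :
  fits p q t -> size (vertices t) < 'C(p + q, p).
Proof.
elim: t p q => [|v l IHl r IHr] [|p] [|q] //=; first by rewrite bin_gt0; lia.
case/andP=> /IHl hl /IHr hr; rewrite size_cat addSn binS.
by rewrite addSnnS in hr; lia.
Qed.

(** * Search trees for a coloring of triples *)

Section ThreeUniform.
Variables (T : finType) (col : {set T} -> bool).
Implicit Types (S H : {set T}) (t : vtree T).

(* [below v b S t]: the color of [v; u; w] is [b] for [u] in [t] and [w] either a
   candidate or a descendant of [u]. *)
Fixpoint below (v : T) (b : bool) S t : Prop :=
  if t is node u l r then
    [/\ forall w, (w \in S) || (w \in vertices l ++ vertices r) ->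
          col [set v; u; w] = b,
        below v b S l & below v b S r]
  else True.

Fixpoint coherent S t : Prop :=
  if t is node v l r then
    [/\ below v false S l, below v true S r, coherent S l & coherent S r]
  else True.

Lemma below_sub v b S S' t : S' \subset S -> below v b S t -> below v b S' t.
Proof.
move=> /subsetP sS; elim: t => //= u l IHl r IHr [h /IHl hl /IHr hr]; split=> //.
by move=> w /orP[/sS wS|wt]; apply: h; rewrite ?wS ?wt ?orbT.
Qed.

Lemma coherent_sub S S' t : S' \subset S -> coherent S t -> coherent S' t.
Proof.
move=> sS; elim: t => //= v l IHl r IHr [bl br /IHl hl /IHr hr].
by split=> //; apply: below_sub sS _.
Qed.

Lemma majority (D : {set T}) (f : T -> bool) :
  exists b, #|D| <= #|[set w in D | f w == b]| * 2.
Proof.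
have <- : #|[set w in D | f w == true]| + #|[set w in D | f w == false]| = #|D|.
  rewrite -(cardsID [set w | f w] D); congr (_ + _); apply: eq_card => w.
    by rewrite !inE eqb_id.
  by rewrite !inE eqbF_neg andbC.
case: (leqP #|[set w in D | f w == true]| #|[set w in D | f w == false]|) => h.
  by exists false; lia.
by exists true; lia.
Qed.

(** Each vertex met on the descent at most halves the candidates. The last clause strengthens the
    induction: applied to the root and the subtree entered, it restores [below] after the
    insertion. *)
Lemma insert_vertex S t x : x \in S -> coherent S t ->
  exists t' S', [/\ S' \subset S :\ x, #|S :\ x| <= #|S'| * 2 ^ height t,
    perm_eq (vertices t') (x :: vertices t), coherent S' t' &
    forall v b, below v b S t -> (forall w, w \in S' -> col [set v; x; w] = b) ->
      below v b S' t'].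
Proof.
elim: t S => [|v l IHl r IHr] S xS /=.
  move=> _; exists (node x leaf leaf), (S :\ x); split=> //=.
    by rewrite expn0 muln1.
  by move=> v b _ h; split=> // w; rewrite orbF; apply: h.
case=> bl br cl cr.
have [b hb] := majority (S :\ x) (fun w => col [set v; x; w]).
set D := [set w in _ | _] in hb.
(* The descent continues with candidates [x |: D], since [x] must itself be one; removing it gives
   back [D]. *)
have sDS : x |: D \subset S.
  by rewrite subUset sub1set xS; apply/subsetP => w; rewrite !inE -!andbA => /and3P[].
have xD : (x |: D) :\ x = D.
  by rewrite setU1K // !inE eqxx.
have xx : x \in x |: D by rewrite setU11.
have colD w : w \in D -> col [set v; x; w] = b by rewrite inE => /andP[_ /eqP].
have sub S' : S' \subset D -> S' \subset S :\ x.
  by move=> /subset_trans; apply; apply/subsetP => w; rewrite inE => /andP[].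
have sDS' : D \subset S by apply: subset_trans (subsetUr _ _) sDS.
have shrink h S' : #|D| <= #|S'| * 2 ^ h -> h <= maxn (height l) (height r) ->
    #|S :\ x| <= #|S'| * 2 ^ (maxn (height l) (height r)).+1.
  move=> h1 h2; apply: leq_trans hb _; rewrite expnSr mulnA leq_pmul2r //.
  by apply: leq_trans h1 _; rewrite leq_mul2l leq_exp2l // h2 orbT.
clearbody D; case: b colD {hb} => colD.
  have [r' [S' [sS' cS' pr cr' br']]] := IHr _ xx (coherent_sub _ _ _ sDS cr).
  rewrite xD in sS' cS'; have sS := subset_trans sS' sDS'.
  exists (node v l r'), S'; split=> /=.
  - exact: sub.
  - by apply: shrink cS' _; rewrite leq_maxr.
  - apply/permP => a; move/permP: pr => /(_ a) /=; rewrite !count_cat => ->.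
    by lia.
  - split; [exact: below_sub bl | | exact: coherent_sub cl | by []].
    apply: br' => [|w wS]; first exact: below_sub br.
    by apply: colD; apply: (subsetP sS').
  move=> u b [hu bul bur] hx; split; last 1 first.
  - by apply: br' => //; apply: below_sub bur.
  - move=> w; rewrite mem_cat (perm_mem pr) inE => /orP[wS|].
      by apply: hu; rewrite (subsetP sS).
    case/or3P => [wl|/eqP->|wr]; apply: hu; rewrite ?xS // mem_cat.
      by rewrite wl orbT.
    by rewrite wr !orbT.
  exact: below_sub bul.
have [l' [S' [sS' cS' pl cl' bl']]] := IHl _ xx (coherent_sub _ _ _ sDS cl).
rewrite xD in sS' cS'; have sS := subset_trans sS' sDS'.
exists (node v l' r), S'; split=> /=.
- exact: sub.
- by apply: shrink cS' _; rewrite leq_maxl.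
- apply/permP => a; move/permP: pl => /(_ a) /=; rewrite !count_cat => ->.
  by lia.
- split; [ | exact: below_sub br | by [] | exact: coherent_sub cr].
  apply: bl' => [|w wS]; first exact: below_sub bl.
  by apply: colD; apply: (subsetP sS').
move=> u b [hu bul bur] hx; split; last 1 first.
- exact: below_sub bur.
- move=> w; rewrite mem_cat (perm_mem pl) inE => /orP[wS|].
    by apply: hu; rewrite (subsetP sS).
  rewrite -orbA; case/or3P => [/eqP->|wl|wr]; apply: hu; rewrite ?xS // mem_cat.
    by rewrite wl orbT.
  by rewrite wr !orbT.
by apply: bl' => //; apply: below_sub bul.
Qed.

(* The last clause says that the vertices of [H] lie on one path of [t]: it lets a
   common ancestor be added to [H]. *)
Definition chain (b : bool) S t (H : {set T}) : Prop :=
  [/\ {subset H <= vertices t},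
    forall x y z, x \in H -> y \in H -> z \in H :|: S ->
      uniq [:: x; y; z] -> col [set x; y; z] = b &
    forall v b', below v b' S t -> forall y z, y \in H -> z \in H :|: S ->
      y != z -> col [set v; y; z] = b'].

Lemma chain0 b S t : chain b S t set0.
Proof.
split; first by move=> x; rewrite inE.
  by move=> x y z; rewrite inE.
by move=> v b' _ y z; rewrite inE.
Qed.

Section Node.
(** [s] stands for either child, so that both sides share one argument. *)
Variables (b : bool) (S H : {set T}) (v : T) (l r s : vtree T).
Hypothesis sub_s : {subset vertices s <= vertices l ++ vertices r}.
Hypothesis below_s : forall u b', below u b' S (node v l r) -> below u b' S s.
Hypothesis chain_s : chain b S s H.

Lemma chain_node : chain b S (node v l r) H.
Proof.
have [sH H1 H2] := chain_s; split=> //.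
  by move=> x /sH /sub_s h; rewrite inE h orbT.
by move=> u b' /below_s; apply: H2.
Qed.

Lemma chain_root : below v b S s -> chain b S (node v l r) (v |: H).
Proof.
have [sH H1 H2] := chain_s; move=> bv; split.
- by move=> x /setU1P[->|/sH /sub_s h]; rewrite /= inE ?eqxx ?h ?orbT.
- move=> x y z /setU1P[->|xH] /setU1P[->|yH]; rewrite -setUA => /setU1P[->|zH];
    rewrite /= !inE ?eqxx ?orbT ?andbF //= ?andbT ?negb_or => ne.
  + by apply: (H2 v b bv) => //; case/andP: ne => /andP[].
  + by rewrite (setUC [set x]); apply: (H2 v b bv) => //; case/andP: ne => /andP[].
  + rewrite setUC setUA; apply: (H2 v b bv) => //; first by rewrite inE yH.
    by case/andP: ne => /andP[].
  + by apply: H1; rewrite //= !inE negb_or andbT.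
- move=> u b' bu; have [hu _ _] := bu.
  move=> y z /setU1P[->|yH]; rewrite -setUA => /setU1P[->|zH] ne.
  + by rewrite eqxx in ne.
  + by apply: hu; move: zH; rewrite inE => /orP[/sH/sub_s->|->]; rewrite ?orbT.
  + by rewrite setUAC; apply: hu; rewrite (sub_s _ (sH _ yH)) orbT.
  + by apply: H2 (below_s _ _ bu) _ _ _ _ _.
Qed.
End Node.

(** A child that fails its bound contains a chain. If the color of the chain matches the side of the
    child, the bound was lowered by one there and the root makes up for it; otherwise the chain is
    already long enough. *)
Lemma chain_of_unfit S t p q : uniq (vertices t) -> coherent S t -> ~~ fits p q t ->
  exists b H, #|H| = (if b then q else p) /\ chain b S t H.
Proof.
have trivial t' p' q' : (p' == 0) || (q' == 0) ->
    exists b H, #|H| = (if b then q' else p') /\ chain b S t' H.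
  case/orP=> /eqP->; [exists false | exists true]; exists set0;
    by rewrite cards0; split=> //; apply: chain0.
elim: t p q => [|v l IHl r IHr] [|p] [|q]; try by move=> *; apply: trivial; rewrite ?orbT.
move=> /= /andP[]; rewrite mem_cat negb_or => /andP[vl vr].
rewrite cat_uniq => /and3P[ul _ ur] [bl br cl cr]; rewrite negb_and => nf.
have subl : {subset vertices l <= vertices l ++ vertices r}.
  by move=> w; rewrite mem_cat => ->.
have subr : {subset vertices r <= vertices l ++ vertices r}.
  by move=> w; rewrite mem_cat orbC => ->.
have belowl u b' : below u b' S (node v l r) -> below u b' S l by case.
have belowr u b' : below u b' S (node v l r) -> below u b' S r by case.
case/orP: nf => [/(IHl _ _ ul cl)|/(IHr _ _ ur cr)] [[] [H [cH hH]]].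
- by exists true, H; split=> //; apply: chain_node hH.
- exists false, (v |: H); split; last exact: chain_root subl belowl hH bl.
  rewrite cardsU1 cH; case: hH => sH _ _.
  by case: (boolP (v \in H)) => // /sH; rewrite (negPf vl).
- exists true, (v |: H); split; last exact: chain_root subr belowr hH br.
  rewrite cardsU1 cH; case: hH => sH _ _.
  by case: (boolP (v \in H)) => // /sH; rewrite (negPf vr).
- by exists false, H; split=> //; apply: chain_node hH.
Qed.

(** Here [n] is the number of insertions still affordable; by [fits_size] the tree stops fitting
    before they run out. *)
Lemma grow_unfit p q n S t : uniq (vertices t) -> {in S, forall w, w \notin vertices t} ->
  coherent S t -> 2 ^ (n * (p + q)) <= #|S| -> 'C(p + q, p) <= n + size (vertices t) ->
  exists t' S', [/\ uniq (vertices t'), {in S', forall w, w \notin vertices t'},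
    coherent S' t', 0 < #|S'| & ~~ fits p q t'].
Proof.
elim: n S t => [|n IHn] S t ut dS cS hS hn; last first.
  have [ft|nf] := boolP (fits p q t); last first.
    by exists t, S; split=> //; apply: leq_trans hS; rewrite expn_gt0.
  have /card_gt0P[x xS] : 0 < #|S| by apply: leq_trans hS; rewrite expn_gt0.
  have [t' [S' [sS' cardS' pt ct' _]]] := insert_vertex S t x xS cS.
  apply: (IHn S' t') => //.
  - by rewrite (perm_uniq pt) /= dS.
  - move=> w /(subsetP sS'); rewrite !inE => /andP[wx wS].
    by rewrite (perm_mem pt) inE negb_or wx dS.
  - move: hS; rewrite (cardsD1 x S) xS mulSnr expnD.
    (* With [p + q = d.+1] the descent costs at most [2 ^ d]; the spare factor 2 pays for the loss
       of [x]. *)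
    have hf := fits_height _ _ _ ft; case: (p + q) hf => // d hd; rewrite expnS => hS.
    have h1 : #|S :\ x| <= #|S'| * 2 ^ d.
      by apply: leq_trans cardS' _; rewrite leq_mul2l leq_exp2l // -ltnS hd orbT.
    have : 2 ^ d > 0 by rewrite expn_gt0.
    have : 2 ^ (n * d.+1) > 0 by rewrite expn_gt0.
    by rewrite -(leq_pmul2r (m := 2 ^ d)) ?expn_gt0 //; nia.
  - by rewrite (perm_size pt) /= addnS -addSn.
exists t, S; split=> //.
by apply/negP => /fits_size; rewrite ltnNge hn.
Qed.

Lemma homogeneous_exists m : 2 ^ ('C(m + m, m) * (m + m)) <= #|T| ->
  exists b H, #|H| = m.+1 /\
    forall A : {set T}, A \subset H -> #|A| = 3 -> col A = b.
Proof.
move=> hT.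
have [|||||t [S [ut dS cS /card_gt0P[w wS] nf]]] :=
    grow_unfit m m 'C(m + m, m) [set: T] leaf; rewrite ?cardsT ?addn0 //.
have [b [H [cH [sH H1 _]]]] := chain_of_unfit S t m m ut cS nf.
have wH : w \notin H by apply: contra (dS w wS) => /sH.
exists b, (w |: H); split; first by rewrite cardsU1 wH cH if_same.
have Hw u : u \in w |: H -> u != w -> u \in H.
  by case/setU1P=> [->|//]; rewrite eqxx.
have inS z : z \in w |: H -> z \in H :|: S.
  by rewrite !inE => /orP[/eqP->|->//]; rewrite wS orbT.
move=> A /subsetP sA cA.
have /card_gt2P[x [y [z [[xA yA zA] [xy yz zx]]]]] : 2 < #|A| by rewrite cA.
have [yx zy xz] : [/\ y != x, z != y & x != z].
  by rewrite (eq_sym y) (eq_sym z) (eq_sym x z).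
have -> : A = [set x; y; z].
  apply/esym/eqP; rewrite eqEcard cA !subUset !sub1set xA yA zA /= -setUA.
  by rewrite cardsU1 cards2 yz !inE negb_or xy xz.
(* [H1] allows a candidate only in third position, so [w] is moved there. *)
have [ex|nx] := eqVneq x w.
  rewrite -setUA setUC; apply: H1; rewrite ?inS ?Hw ?sA -?ex //=.
  by rewrite !inE negb_or yz yx zx.
have [ey|ny] := eqVneq y w.
  rewrite setUAC; apply: H1; rewrite ?inS ?Hw ?sA -?ey //=.
  by rewrite !inE negb_or xy xz zy.
by apply: H1; rewrite ?inS ?Hw ?sA //= !inE negb_or xy yz xz.
Qed.
End ThreeUniform.

(** * The Ramsey number and the numerical estimate *)

Lemma ramsey3_le k : ramsey 3 k.+1 <= 2 ^ ('C(k + k, k) * (k + k)).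
Proof.
rewrite /ramsey; case: ex_minnP => n _; apply; apply/forallP => COL.
pose col A := if insub A is Some u then COL u else false.
have [|b [H [cH hH]]] := homogeneous_exists _ col k; first by rewrite card_ord.
have colE (A : asubset _ 3) : val A \subset H -> COL A = b.
  by move=> sA; rewrite -(hH _ sA (eqP (valP A))) /col valK.
apply/existsP; exists H; rewrite cH eqxx andbT.
apply/forallP => A; apply/forallP => B; apply/implyP => sA; apply/implyP => sB.
by rewrite !colE.
Qed.

(** The induction step reduces to [(2m + 1)(2m + 3) <= 4(m + 1)^2]. *)
Lemma central_binomial_sqr m : 'C(m + m, m) ^ 2 * (m + m).+1 <= 16 ^ m.
Proof.
elim: m => [//|m IHm].
have rec : m.+1 * 'C(m.+1 + m.+1, m.+1) = 2 * (m + m).+1 * 'C(m + m, m).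
  rewrite -mul_bin_diag addSn addnS /= -mulnA (mul_bin_down (m + m).+1) /=.
  by rewrite (_ : (m + m).+1 - m = m.+1); nia.
rewrite -(leq_pmul2l (m := m.+1 ^ 2)) // mulnA -expnMn rec !expnMn (expnS 16).
have : (m + m).+1 * (m.+1 + m.+1).+1 <= 4 * m.+1 ^ 2 by nia.
move=> h; have := leq_mul (leq_mul (leqnn (2 ^ 2)) IHm) h.
by move: (_ ^ m) ('C(_, _)) => M c; nia.
Qed.

Import Order.TTheory GRing.Theory Num.Theory.
Local Open Scope ring_scope.

(** The square is the cube of [e^2 / (2 pi)], which is at least [1 / 2] because [e >= 2] and
    [pi < 4]. *)
Lemma ramsey_const_sqr_ge (R : realType) : 8^-1 <= ramsey_const R ^+ 2.
Proof.
have e2 : 2 <= expR 1 :> R by have := expR_ge1Dx (1 : R); lra.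
have pi4 : pi < 4 :> R by have := pihalf_lt2 R; lra.
have pi0 : 0 < pi :> R := pi_gt0 R.
rewrite /ramsey_const -exprM mulnC exprM expr_div_n sqr_sqrtr; last by lra.
rewrite (_ : 8^-1 = 2^-1 ^+ 3); last by field.
apply: lerXn2r; rewrite ?nnegrE ?divr_ge0 ?sqr_ge0 //; first by lra.
by rewrite ler_pdivlMr; nra.
Qed.

Theorem theorem6p2 (R : realType) (k : nat) (hk : (1 <= k)%N) :
  (ramsey 3 k)%:R <=
    2 `^ (ramsey_const R * Num.sqrt (k%:R - 1) * 2 ^+ (2 * k)) :> R.
Proof.
case: k hk => // k _; have := ramsey3_le k; rewrite -(ler_nat R) => /le_trans; apply.
rewrite natrX -[leLHS]powR_mulrn //; apply: ler_powR; first by rewrite ler1n.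
have B0 : 0 <= ramsey_const R by rewrite exprn_ge0 // divr_ge0 ?expR_ge0 ?sqrtr_ge0.
rewrite -[k.+1%:R]natr1 addrK.
(* Squaring the exponents removes the root. As [16 ^ k.+1 / 8 = 2 * 16 ^ k], it suffices to bound
   the left side by [2 k 16 ^ k]. *)
rewrite -(ler_pXn2r (n := 2)) // ?nnegrE ?mulr_ge0 ?sqrtr_ge0 ?exprn_ge0 //.
rewrite [leRHS]exprMn [(ramsey_const R * _) ^+ 2]exprMn sqr_sqrtr //.
have -> : (2 ^+ (2 * k.+1)) ^+ 2 = 16 * (16 ^ k)%:R :> R.
  by rewrite -exprM mulnAC exprM exprS natrX -natrX.
have := central_binomial_sqr k; rewrite -(ler_nat R) -mulnn !natrM -natr1 natrD.
have := ramsey_const_sqr_ge R; have : 0 <= k%:R :> R by [].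
have : 0 <= (16 ^ k)%:R :> R by [].
move: (ramsey_const R ^+ 2) (16 ^ k)%:R k%:R ('C(_, _)%:R) => B M x c M0 x0 hB hC.
have h1 : (c * (x + x)) ^+ 2 <= M * (2 * x).
  have := ler_wpM2r (mulr_ge0 (ler0n R 2) x0) hC.
  by have := mulr_ge0 (sqr_ge0 c) x0; lra.
apply: le_trans h1 _; have := ler_wpM2r (mulr_ge0 M0 x0) hB; lra.
Qed.
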